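(* Suppose that every agent $i$ measures its body velocities $(\mathbf v_i^i,\boldsymbol\omega_i^i)$ and the relative transformations $\mathbf T_{ij}$, $j\in\mathcal N_i$, and that the interaction graph $\mathcal G$ contains a spanning tree. Let the auxiliary matrices $\mathbf P_i(t)=\begin{bmatrix}\mathbf Q_i(t)&\mathbf q_i(t)\\ \mathbf 0&1\end{bmatrix}$, $i=1,\dots,n$, evolve under the frame localization law $$\dot{\mathbf P}_i(t)=-\begin{bmatrix}\mathbf v_i^i\\ \boldsymbol\omega_i^i\end{bmatrix}^{\wedge}\mathbf P_i(t)+\sum_{j\in\mathcal N_i}\big(\mathbf T_{ij}(t)\mathbf P_j(t)-\mathbf P_i(t)\big),\qquad i=1,\dots,n.$$ Let $\hat{\mathbf R}_i^\top(t)$ be constructed from $\mathbf Q_i(t)$ by the Gram–Schmidt procedure, $\hat{\mathbf R}_i^\top(t)=\mathrm{GSOP}(\mathbf Q_i(t))$, let $\hat{\mathbf p}_i(t):=-\hat{\mathbf R}_i(t)\mathbf q_i(t)$, and let $\hat{\mathbf T}_i(t):=\begin{bmatrix}\hat{\mathbf R}_i(t)&\hat{\mathbf p}_i(t)\\ \mathbf 0&1\end{bmatrix}$. Let $$\mathbf Z_0:=\big[(\mathbf R_1(0)\mathbf Q_1(0))^\top,\dots,(\mathbf R_n(0)\mathbf Q_n(0))^\top\big]^\top\in\mathbb R^{3n\times3}.$$ If $\mathrm{Range}(\mathbf Z_0)\cap\mathrm{null}(\mathbf w_1\otimes\mathbf I_3)=\{\mathbf 0\}$, then there exists an (unknown)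 constant transformation, common to all agents, $$\mathbf T_c:=\begin{bmatrix}\mathbf R_c&\mathbf q_c\\ \mathbf 0&1\end{bmatrix}\in SE(3)$$ such that $$\hat{\mathbf T}_i(t)\to\mathbf T_c^{-1}\mathbf T_i(t)\quad\text{as }t\to\infty,\ \text{for all } i\in\mathcal V,$$ that is, $\hat{\mathbf R}_i\to\mathbf R_c^\top\mathbf R_i$ and $\hat{\mathbf p}_i\to\mathbf R_c^\top(\mathbf p_i-\mathbf q_c)$ as $t\to\infty$.
   Context: There are $n$ agents in $\mathbb R^3$. Agent $i$ has a time-varying pose $\mathbf T_i(t)=\begin{bmatrix}\mathbf R_i(t)&\mathbf p_i(t)\\ \mathbf 0&1\end{bmatrix}\in SE(3)$, with $\mathbf R_i\in SO(3)$, $\mathbf p_i\in\mathbb R^3$, satisfying $\dot{\mathbf T}_i=\mathbf T_i\begin{bmatrix}\mathbf v_i^i\\ \boldsymbol\omega_i^i\end{bmatrix}^{\wedge}$, where $\mathbf v_i^i,\boldsymbol\omega_i^i\in\mathbb R^3$ are the linear and angular velocities of agent $i$ in its body frame. Here $\begin{bmatrix}\mathbf v\\ \boldsymbol\omega\end{bmatrix}^{\wedge}=\begin{bmatrix}\boldsymbol\omega^\wedge&\mathbf v\\ \mathbf 0&0\end{bmatrix}\in\mathbb R^{4\times4}$ and $\boldsymbol\omega^\wedge\in\mathbb R^{3\times3}$ is the skew-symmetric matrix with $\boldsymbol\omega^\wedge\mathbf x=\boldsymbol\omega\times\mathbf x$. The relative transformation is $\mathbf T_{ij}=\mathbf T_i^{-1}\mathbf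 T_j$. All measurements are noise-free. The interaction graph is $\mathcal G=(\mathcal V,\mathcal E)$, $\mathcal V=\{1,\dots,n\}$, possibly directed; $(i,j)\in\mathcal E$ means agent $i$ measures $\mathbf T_{ij}$ and receives information from $j$; $\mathcal N_i=\{j:(i,j)\in\mathcal E\}$. The Laplacian $\mathbf L=[l_{ij}]$ has $l_{ij}=-1$ if $(i,j)\in\mathcal E$, $i\ne j$, $l_{ii}=-\sum_{j\in\mathcal N_i}l_{ij}$, and $l_{ij}=0$ otherwise. ''$\mathcal G$ contains a spanning tree'' means there is a root vertex $r$ from which information can reach every agent, i.e. for every $i\in\mathcal V$ there is a directed path $i=i_0,i_1,\dots,i_k=r$ with $(i_l,i_{l+1})\in\mathcal E$. The row vector $\mathbf w_1=[w_{11},\dots,w_{1n}]$ is the left eigenvector of $\mathbf L$ for the zero eigenvalue, normalized by $\mathbf w_1\mathbf 1_n=1$, where $\mathbf 1_n$ is the all-ones vector; $\otimes$ is the Kronecker product and $\mathbf I_3$ the $3\times3$ identity. Each $\mathbf P_i\in\mathbb R^{4\times4}$ has the displayed block form with $\mathbf Q_i\in\mathbb R^{3\times3}$, $\mathbf q_i\in\mathbb R^3$; $\mathbf Q_i(0)$ is nonsingular and initialized randomly. The constants are $\mathbf q_c:=\sum_{i=1}^n w_{1i}\big(\mathbf R_i(0)\mathbf q_i(0)+\mathbf p_i(0)\big)\in\mathbb R^3$, $\mathbf Q_c:=\sum_{i=1}^n w_{1i}\mathbf R_i(0)\mathbf Q_i(0)\in\mathbb R^{3\times3}$ and $\mathbf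 R_c:=\mathrm{GSOP}(\mathbf Q_c)$. GSOP: for a matrix with columns $\mathbf z_1,\mathbf z_2,\mathbf z_3\in\mathbb R^3$, set $\mathbf u_k=\mathbf z_k-\sum_{l<k}\langle\mathbf z_k,\mathbf y_l\rangle\mathbf y_l$, $\mathbf y_k=\mathbf u_k/\|\mathbf u_k\|$ for $k=1,2$, and $\mathbf y_3=\beta\,\mathbf u_3/\|\mathbf u_3\|$ with $\beta=\mathrm{sign}\det[\mathbf y_1,\mathbf y_2,\mathbf u_3/\|\mathbf u_3\|]$; if some $\mathbf u_k=\mathbf 0$, put $\mathbf y_k=\mathbf 0$. The output is $[\mathbf y_1,\mathbf y_2,\mathbf y_3]$, which lies in $SO(3)$ when the input is nonsingular.
   Formalization: The limits T̂_i−T_c^{-1}T_i→0 and p̂_i−R_c^T(p_i−q_c)→0 are proved only when p_i(t) grows slower than every exponential (e.g. bounded velocities), as they fail for p_i like e^{t²}; R̂_i→R_c^T R_i and T̂_i T_i^{-1}→T_c^{-1} need no such condition. *)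

(* Defs.v *)
(* MathComp / MathComp-Analysis. *)
From HB Require Import structures.
From mathcomp Require Import all_boot all_order all_algebra.
From mathcomp Require Import all_classical all_reals all_analysis.
From mathcomp.real_closed Require Export mxtens.
Set Implicit Arguments.
Unset Strict Implicit.
Unset Printing Implicit Defensive.
Import Order.TTheory GRing.Theory Num.Theory.
Import numFieldNormedType.Exports.
Local Open Scope classical_set_scope.
Local Open Scope ring_scope.

Section RigidMotions.
Variable R : realType.

Definition SO3 (A : 'M[R]_3) : Prop := A^T *m A = 1%:M /\ \det A = 1.

Definition homog (A : 'M[R]_3) (b : 'cV[R]_3) : 'M[R]_(3 + 1) :=
  block_mx A b 0 1%:M.

Definition SE3 (T : 'M[R]_(3 + 1)) : Prop :=
  exists A b, SO3 A /\ T = homog A b.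

(* The matrix of the cross product x |-> w \times x. *)
Definition hat3 (w : 'cV[R]_3) : 'M[R]_3 :=
  \matrix_(i, j)
    (nth [::] [:: [::       0; - w 2 0;   w 1 0];
                  [::   w 2 0;       0; - w 0 0];
                  [:: - w 1 0;   w 0 0;       0]] i)`_j.

Definition twist (v w : 'cV[R]_3) : 'M[R]_(3 + 1) :=
  block_mx (hat3 w) v 0 0.

(* [`| _ |] is the sup norm on matrices, so the Euclidean structure needed by
   the Gram-Schmidt procedure is spelled out. *)
Definition dot (x y : 'cV[R]_3) : R := \sum_i x i 0 * y i 0.

(* Since 0^-1 = 0, [normalize 0 = 0]. *)
Definition normalize (x : 'cV[R]_3) : 'cV[R]_3 :=
  (Num.sqrt (dot x x))^-1 *: x.

Definition cols3 (a b c : 'cV[R]_3) : 'M[R]_3 :=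
  \matrix_(i, j) (nth 0 [:: a; b; c] j) i 0.

Definition GSOP (Z : 'M[R]_3) : 'M[R]_3 :=
  let z1 := col 0 Z in let z2 := col 1 Z in let z3 := col 2 Z in
  let y1 := normalize z1 in
  let y2 := normalize (z2 - dot z2 y1 *: y1) in
  let y := normalize (z3 - (dot z3 y1 *: y1 + dot z3 y2 *: y2)) in
  let beta := Num.sg (\det (cols3 y1 y2 y)) in
  cols3 y1 y2 (beta *: y).

(* The estimate [Rhat, phat; 0, 1] read off from P = [Q, q; 0, 1]. *)
Definition Rhat (Q : 'M[R]_3) : 'M[R]_3 := (GSOP Q)^T.
Definition phat (Q : 'M[R]_3) (q : 'cV[R]_3) : 'cV[R]_3 := - (Rhat Q *m q).
Definition That (Q : 'M[R]_3) (q : 'cV[R]_3) : 'M[R]_(3 + 1) :=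
  homog (Rhat Q) (phat Q q).

End RigidMotions.

Section Graphs.
Variables (R : realType) (n : nat).

(* Self-loops are ignored: they contribute nothing to the localization law. *)
Definition laplacian (E : rel 'I_n) : 'M[R]_n :=
  \matrix_(i, j) if i == j then (\sum_(k | E i k && (k != i)) 1)
                 else if E i j then -1 else 0.

Definition has_spanning_tree (E : rel 'I_n) : Prop :=
  exists r, forall i, connect E i r.

End Graphs.

Section Dynamics.
Variable R : realType.

(* X is a solution on [0, +oo[ of X' = F; the derivative at the left endpoint
   is not required, only continuity there. *)
Definition solves m (X F : R -> 'M[R]_m) : Prop :=
  {within `[0, +oo[, continuous X} /\
  forall t : R, 0 < t -> is_derive t (1 : R) X (F t).

Definition frames n (A : 'I_n -> R -> 'M[R]_3) (b : 'I_n -> R -> 'cV[R]_3)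
  (i : 'I_n) (t : R) : 'M[R]_(3 + 1) := homog (A i t) (b i t).

Definition localization_law n (E : rel 'I_n)
    (v w : 'I_n -> R -> 'cV[R]_3) (T P : 'I_n -> R -> 'M[R]_(3 + 1))
    (i : 'I_n) (t : R) : 'M[R]_(3 + 1) :=
  - (twist (v i t) (w i t) *m P i t)
  + \sum_(j | E i j) (invmx (T i t) *m T j t *m P j t - P i t).

Definition Z0 n (A B : 'I_n -> 'M[R]_3) : 'M[R]_(n * 3, 3) :=
  \matrix_(k, j) (A (mxtens_unindex k).1 *m B (mxtens_unindex k).1)
                   (mxtens_unindex k).2 j.

Definition col_range m n (A : 'M[R]_(m, n)) : set 'cV[R]_m :=
  range (fun x : 'cV[R]_n => A *m x).
Definition col_null m n (A : 'M[R]_(m, n)) : set 'cV[R]_n :=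
  [set x | A *m x = 0].

Definition qc n (w1 : 'rV[R]_n) (A : 'I_n -> 'M[R]_3) (p q : 'I_n -> 'cV[R]_3) :
  'cV[R]_3 := \sum_i w1 0 i *: (A i *m q i + p i).
Definition Qc n (w1 : 'rV[R]_n) (A B : 'I_n -> 'M[R]_3) : 'M[R]_3 :=
  \sum_i w1 0 i *: (A i *m B i).

(* Growth slower than every exponential, e.g. under bounded linear velocity
   (then b grows at most linearly).  phat multiplies the position by a rotation
   error that decays exponentially and no faster in general, so phat cannot
   track a position that grows arbitrarily fast. *)
Definition subexponential (b : R -> 'cV[R]_3) : Prop :=
  forall a : R, 0 < a -> (expR (- a * t) *: b t) @[t --> +oo] --> (0 : 'cV[R]_3).

End Dynamics.

Arguments laplacian R {n} E.

(* Main.v *)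
Require Import Defs.
From HB Require Import structures.
From mathcomp Require Import all_boot all_order all_algebra.
From mathcomp Require Import all_classical all_reals all_analysis.
From mathcomp Require Import ring lra.
Set Implicit Arguments.
Unset Strict Implicit.
Unset Printing Implicit Defensive.
Import Order.TTheory GRing.Theory Num.Theory.
Import numFieldNormedType.Exports.
Local Open Scope classical_set_scope.
Local Open Scope ring_scope.

(** In the inertial frame the law is linear. Put S_i = T_i P_i. Differentiating,
    the twist terms cancel and

      S_i' = sum over j in N_i of (S_j - S_i),

    so that every entry of S_i evolves by the plain consensus dynamics
    x' = - L x, with the same Laplacian for all entries. The upper blocks of S_i
    are R_i Q_i and R_i q_i + p_i.

    Consensus is exponential when some root r is reachable from everywhere. The
    extreme values of x can only move inwards (flow_ge, flow_le). Moreover, if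
    a bounds x from below at time s, then x_r - a decays at worst like
    exp(- n t), and it feeds x_i along a path i, ..., r of length k as
    (t - s)^k / k! (flow_growth). After one unit of time every x_i has therefore
    gained a fixed fraction of x_r - a from below and, symmetrically, of b - x_r
    from above: the interval [a, b] containing all values shrinks by a constant
    factor (flow_contraction). Since w1 x is conserved and w1 sums to 1, the
    common limit is w1 x(0) (consensus_exponential). Applied to the entries of
    S_i this gives R_i Q_i -> Qc and R_i q_i + p_i -> qc, exponentially
    (auxiliary_frames_converge).

    The range condition says exactly that Qc x = 0 forces R_i(0) Q_i(0) x = 0
    for all i, whence Qc is invertible (Qc_unitmx). Near an invertible matrix the
    Gram-Schmidt procedure is built from sums, products, inverses of nonzero
    numbers, square roots of positive numbers and the sign of a nonzero
    determinant, all of which preserve exponential convergence at a given rate;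
    hence G_i = GSOP (R_i Q_i) converges to Rc = GSOP Qc exponentially
    (mx_exp_cvg_GSOP). Finally GSOP (A Z) = A GSOP Z for a rotation A
    (GSOP_mulmx), so the estimates are

      Rhat_i = G_i^T R_i,      phat_i = G_i^T p_i - G_i^T (R_i q_i + p_i),

    and That_i T_i^-1 = [G_i^T, - G_i^T (R_i q_i + p_i); 0, 1] tends to Tc^-1.
    The error of phat_i contains (G_i - Rc)^T p_i, the product of an
    exponentially small matrix with the position: it vanishes in the limit when
    p_i grows subexponentially. *)

(** * Consensus dynamics on a directed graph *)

Section Consensus.
Context {R : realType} {n : nat} (E : rel 'I_n).
Implicit Types (x : 'I_n -> R -> R) (i j : 'I_n) (a b s t : R).

Definition consensus_flow x : Prop :=
  (forall i, {within `[0, +oo[, continuous (x i)}) /\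
  (forall i t, 0 < t ->
     is_derive t (1 : R) (x i) (\sum_(j | E i j) (x j t - x i t))).

(** Left difference quotients at a minimum from the left are nonpositive; the
    usual statement for interior minima would not cover the right end of the
    segments on which the extreme value theorem is applied. *)
Lemma left_min_derive_le0 (f : R -> R) (df s c : R) :
  s < c -> is_derive c (1 : R) f df -> (forall t, s <= t <= c -> f c <= f t) ->
  df <= 0.
Proof.
move=> sc [fc <-] cmin; rewrite leNgt; apply/negP => df0.
have : h^-1 *: ((f \o shift c) (h *: (1 : R)) - f c) @[h --> 0^'-] --> 'D_1 f c.
  exact: (cvg_dnbhs_at_left (p := 0)).
move=> /cvgr_gt /(_ _ df0) H.
have [h /= [h0 hs hq]] : exists h : R, [/\ h < 0, s - c < h &
    0 < h^-1 *: ((f \o shift c) (h *: (1 : R)) - f c)].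
  apply: (@filter_ex _ (0 : R)^'-); near=> h; split; first by [].
    by near: h; apply: nbhs_left_gt; rewrite subr_lt0.
  by near: h.
move: hq; rewrite /= /shift /= scaler1 /GRing.scale /= nmulr_rgt0 ?invr_lt0//.
rewrite subr_lt0 ltNge cmin//; apply/andP; split; lra.
Unshelve. all: by end_near. Qed.

Lemma consensus_flowN x : consensus_flow x -> consensus_flow (fun i => - x i).
Proof.
move=> [cx dx]; split=> [i|i t t0].
  by move=> u; apply: continuousN; exact: cx.
have := dx i t t0; move=> /is_deriveN /is_derive_eq; apply.
by rewrite -sumrN; apply: eq_bigr => j _; rewrite !fctE; ring.
Qed.

Lemma flow_segment_continuous x i s t :
  consensus_flow x -> 0 <= s -> {within `[s, t], continuous (x i)}.
Proof.
move=> [cx _] s0; apply: continuous_subspaceW (cx i) => u /=.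
by rewrite !in_itv/= andbT => /andP[su _]; exact: le_trans su.
Qed.

(** Minimum principle. Tilting x by a small positive slope k makes every
    derivative at a global minimum of the tilted functions (over agents and
    times) strictly positive, which is impossible after the initial time; then
    the slope tends to 0. *)
Lemma flow_ge x s t a i : consensus_flow x -> 0 <= s <= t ->
  (forall j, a <= x j s) -> a <= x i t.
Proof.
move=> fx /andP[s0 st] xa; apply/ler_addgt0Pr => e e0.
(* The tilt is at most e over the whole segment. *)
pose k := e / (1 + (t - s)).
have ts1 : 0 < 1 + (t - s) by lra.
have k0 : 0 < k by rewrite divr_gt0.
pose z j u := x j u + k * (u - s).
have zE j : z j = x j + k \*: (id - cst s) by apply/funext.
have cz j : {within `[s, t], continuous (z j)}.
  rewrite zE => u; apply: continuousD.
    exact: (flow_segment_continuous fx s0).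
  apply: continuous_subspaceT => v /=.
  by apply: cvgZl_tmp; apply: cvgB; [exact: cvg_id|exact: cvg_cst].
have /choice[c cP] : forall j, exists c, s <= c <= t /\
    forall u, s <= u <= t -> z j c <= z j u.
  move=> j; have [c cst cmin] := EVT_min st (cz j).
  exists c; split; first by move: cst; rewrite in_itv.
  by move=> u ust; apply: cmin; rewrite in_itv.
have [j _ jmin] := @Order.TotalTheory.arg_minP _ _ _ i xpredT (fun j => z j (c j)) isT.
have [/andP[sc ct] cmin] := cP j.
have zge : z j (c j) <= z i t.
  apply: le_trans (jmin i isT) _; apply: (cP i).2; lra.
have za : a <= z j (c j).
  have [cs|cNs] := eqVneq (c j) s.
    by rewrite /z cs subrr mulr0 addr0.
  have {cNs} sc' : s < c j by rewrite lt_neqAle eq_sym cNs.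
  have c0 : 0 < c j by apply: le_lt_trans s0 sc'.
  have dz : is_derive (c j) (1 : R) (z j)
      (\sum_(l | E j l) (x l (c j) - x j (c j)) + k).
    rewrite zE; apply: is_deriveD; first exact: fx.2.
    by apply: is_derive_eq; rewrite subr0 scaler1.
  suff : 0 < \sum_(l | E j l) (x l (c j) - x j (c j)) + k.
    rewrite ltNge (left_min_derive_le0 sc' dz)// => u /andP[su uc].
    by apply: cmin; rewrite su (le_trans uc).
  rewrite ltr_wpDl// sumr_ge0// => l _.
  have -> : x l (c j) - x j (c j) = z l (c j) - z j (c j) by rewrite /z; ring.
  rewrite subr_ge0 (le_trans (jmin l isT))//; apply: (cP l).2; exact/andP.
apply: le_trans za (le_trans zge _); rewrite /z lerD2l /k -mulrA.
by apply: ler_piMr; [exact: ltW|rewrite ler_pdivrMl// mulr1; lra].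
Qed.

Lemma flow_le x s t b i : consensus_flow x -> 0 <= s <= t ->
  (forall j, x j s <= b) -> x i t <= b.
Proof.
move=> /consensus_flowN fx st xb; rewrite -lerN2.
by apply: (flow_ge (x := fun i => - x i) i fx st) => j; rewrite !fctE lerN2.
Qed.

Lemma le_of_derive_ge0 (f df : R -> R) s t : s <= t ->
  {within `[s, t], continuous f} ->
  (forall u, s < u < t -> is_derive u (1 : R) f (df u)) ->
  (forall u, s < u < t -> 0 <= df u) -> f s <= f t.
Proof.
move=> st cf df1 df0.
apply: (@ger0_derive1_le_cc _ f s t); rewrite ?in_itv/= ?lexx ?st//.
  by move=> u; rewrite in_itv/= => /df1[].
by move=> u; rewrite in_itv/= => su; rewrite derive1E; have [_ ->] := df1 _ su; exact: df0.
Qed.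


(** The weight exp(n (t - s)) absorbs the loss - d_i (x_i - a), the out-degree
    d_i being at most n. *)
Lemma is_derive_weighted_excess x i s a t : consensus_flow x -> 0 < t ->
  is_derive t (1 : R) (fun u => expR (n%:R * (u - s)) * (x i u - a))
    (expR (n%:R * (t - s)) *
      (n%:R * (x i t - a) + \sum_(j | E i j) (x j t - x i t))).
Proof.
move=> fx t0.
have de : is_derive t (1 : R) (fun u => expR (n%:R * (u - s)))
    (expR (n%:R * (t - s)) * n%:R).
  have dl : is_derive t (1 : R) (n%:R \*: (id - cst s)) n%:R.
    by apply: is_derive_eq; rewrite subr0 scaler1.
  by apply: is_derive_eq (is_derive1_comp (is_derive_expR _) dl) _; rewrite mulrC.
have dx : is_derive t (1 : R) (x i - cst a) (\sum_(j | E i j) (x j t - x i t)).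
  apply: is_derive_eq (is_deriveB (fx.2 i t t0) (is_derive_cst _ _ _)) _.
  exact: subr0.
by apply: is_derive_eq (is_deriveM de dx) _; rewrite /GRing.scale /= !fctE; ring.
Qed.

(** The divided powers (t - s)^k / k! are primitives of one another: they give
    the time profile of the influence of the root at distance k. *)
Lemma is_derive_divided_power k s t :
  is_derive t (1 : R) (fun u => (u - s) ^+ k.+1 / k.+1`!%:R)
    ((t - s) ^+ k / k`!%:R).
Proof.
have dl : is_derive t (1 : R) (id - cst s) 1.
  by apply: is_derive_eq; rewrite subr0.
have -> : (fun u => (u - s) ^+ k.+1 / k.+1`!%:R) =
    (id - cst s) ^+ k.+1 * cst (k.+1`!%:R^-1).
  by apply/funext => u; rewrite !fctE.
apply: is_derive_eq (is_deriveM (is_deriveX k.+1 dl) (is_derive_cst _ _ _)) _.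
rewrite scaler0 add0r /GRing.scale /= factS natrM !fctE.
have fk : (k`!%:R : R) != 0 by rewrite pnatr_eq0 -lt0n fact_gt0.
have k1 : (k.+1%:R : R) != 0 by rewrite pnatr_eq0.
by field; rewrite fk addrC natr1 k1.
Qed.

(** By induction on the path: once weighted, the derivative of the excess
    x_i - a is at least the weighted excess of the next agent on the path, which
    is bounded below by a divided power; integrate once more for each edge. No
    intermediate times have to be chosen. *)
Lemma flow_growth x s a r i (p : seq 'I_n) : consensus_flow x -> 0 <= s ->
  (forall j, a <= x j s) -> path E i p -> last i p = r ->
  forall t, s <= t ->
  (x r s - a) * ((t - s) ^+ size p / (size p)`!%:R)
    <= expR (n%:R * (t - s)) * (x i t - a).
Proof.
move=> fx s0 xa.
have y0 j u : s <= u -> 0 <= x j u - a.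
  by move=> su; rewrite subr_ge0; apply: (flow_ge j fx _ xa); rewrite s0.
(* Discard the nonnegative term (n - d_j) (x_j - a). *)
have gain j u : s <= u -> \sum_(l | E j l) (x l u - a) <=
    n%:R * (x j u - a) + \sum_(l | E j l) (x l u - x j u).
  move=> su; rewrite -lerBlDr -sumrB.
  rewrite (eq_bigr (fun=> x j u - a)); last by move=> l _; ring.
  rewrite sumr_const -[leLHS]mulr_natl ler_wpM2r ?y0// ler_nat.
  by rewrite -[leqRHS]card_ord max_card.
have ce j t : {within `[s, t], continuous (fun u => expR (n%:R * (u - s)) * (x j u - a))}.
  have -> : (fun u => expR (n%:R * (u - s)) * (x j u - a)) =
      (fun u => expR (n%:R * (u - s))) * (x j - cst a) by [].
  move=> u; apply: continuousM; last first.
    apply: continuousB; last exact: cst_continuous.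
    exact: (flow_segment_continuous fx s0).
  apply: continuous_subspaceT => v; apply: continuous_comp; last exact: continuous_expR.
  by apply: cvgZl_tmp; apply: cvgB; [exact: cvg_id|exact: cvg_cst].
elim: p i => [|j p IH] i /= => [_ ->|/andP[Eij pj] lastr] t st.
  rewrite fact0 expr0 divr1 mulr1.
  have := le_of_derive_ge0 st (ce r t)
    (fun u su => is_derive_weighted_excess r s a fx (le_lt_trans s0 (proj1 (andP su)))).
  rewrite subrr mulr0 expR0 mul1r; apply=> u /andP[su _].
  rewrite mulr_ge0 ?expR_ge0// (le_trans _ (gain _ _ (ltW su)))// sumr_ge0// => l _.
  exact/y0/ltW.
pose g u := expR (n%:R * (u - s)) * (x i u - a).
pose h u := (u - s) ^+ (size p).+1 / (size p).+1`!%:R.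
have fst : (g - (x r s - a) \*: h) s <= (g - (x r s - a) \*: h) t.
  apply: (@le_of_derive_ge0 _ (fun u => expR (n%:R * (u - s)) *
      (n%:R * (x i u - a) + \sum_(j | E i j) (x j u - x i u))
      - (x r s - a) * ((u - s) ^+ size p / (size p)`!%:R)) _ _ st).
  - move=> u; apply: continuousB; first exact: ce.
    apply: continuous_subspaceT => v; apply: cvgZl_tmp.
    have [/derivable1_diffP/differentiable_continuous dp _] :=
      is_derive_divided_power (size p) s v.
    exact: dp.
  - move=> u /andP[su _].
    have dg := is_derive_weighted_excess i s a fx (le_lt_trans s0 su).
    exact: is_deriveB dg (is_deriveZ _ (is_derive_divided_power _ s u)).
  - move=> u /andP[/ltW su _]; rewrite subr_ge0.
    apply: le_trans (IH j pj lastr u su) _; rewrite ler_pM2l ?expR_gt0//.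
    apply: le_trans (gain i u su); rewrite (bigD1 j)//= lerDl sumr_ge0// => l _.
    exact: y0.
have {fst} : g s - (x r s - a) * h s <= g t - (x r s - a) * h t := fst.
rewrite /g /h !subrr mulr0 expR0 mul1r expr0n/= mul0r mulr0 subr0 => H.
by rewrite -subr_ge0; apply: le_trans H; rewrite y0.
Qed.

(** The share of the excess of the root that flow_growth guarantees at time
    s + 1 along every path of length at most n. *)
Definition contraction_rate : R := expR (- n%:R) / n`!%:R.

Lemma contraction_rate_gt0 : 0 < contraction_rate.
Proof. by rewrite divr_gt0 ?expR_gt0// ltr0n fact_gt0. Qed.

Lemma flow_unit_time_gain x s a r i : consensus_flow x -> 0 <= s ->
  (forall j, a <= x j s) -> connect E i r ->
  a + contraction_rate * (x r s - a) <= x i (s + 1).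
Proof.
move=> fx s0 xa /connectP[p0 pE0 ->].
case: (shortenP pE0) => p pE uniq_p _ {p0 pE0}; rewrite addrC -lerBrDr.
have xr0 : 0 <= x (last i p) s - a by rewrite subr_ge0.
have sn : (size p <= n)%N.
  have := max_card (mem (i :: p)); rewrite card_ord (card_uniqP uniq_p).
  exact: ltnW.
have := flow_growth fx s0 xa pE erefl (t := s + 1); rewrite lerDl ler01 => /(_ isT).
rewrite addrAC subrr add0r expr1n mulr1 mul1r => H.
rewrite /contraction_rate expRN -mulrA ler_pdivrMl ?expR_gt0//.
apply: le_trans H; rewrite mulrC ler_wpM2l// lef_pV2 ?posrE ?ltr0n ?fact_gt0// ler_nat.
exact: leq_fact.
Qed.

(** In each unit of time the lower bound a moves up by c (x_r - a) and the
    upper bound b moves down by c (b - x_r), where c is the contraction rate;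
    the sum of these two gains is c (b - a), whatever the position of x_r. *)
Lemma flow_contraction x r : (forall i, connect E i r) -> consensus_flow x ->
  forall a b, (forall j, a <= x j 0 <= b) ->
  forall k : nat, exists ak bk, (forall j, ak <= x j k%:R <= bk) /\
    bk - ak = (1 - contraction_rate) ^+ k * (b - a).
Proof.
move=> Er fx a b x0; elim=> [|k [ak [bk [xk IH]]]].
  by exists a, b; rewrite expr0 mul1r.
exists (ak + contraction_rate * (x r k%:R - ak)),
  (bk + contraction_rate * (x r k%:R - bk)); split=> [j|]; last first.
  by rewrite exprS -mulrA -IH; ring.
rewrite -natr1; apply/andP; split.
  by apply: flow_unit_time_gain => // l; case/andP: (xk l).
rewrite -lerN2.
have := @flow_unit_time_gain (fun i => - x i) k%:R (- bk) r j (consensus_flowN fx).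
rewrite !fctE => H; apply: le_trans (H _ _ _) => //.
  by rewrite le_eqVlt; apply/orP; left; apply/eqP; ring.
by move=> l; rewrite lerN2; case/andP: (xk l).
Qed.

Lemma contraction_rate_le1 : contraction_rate <= 1.
Proof.
rewrite ler_pdivrMr ?ltr0n ?fact_gt0// mul1r.
apply: (@le_trans _ _ 1); last by rewrite ler1n fact_gt0.
by rewrite -expR0 ler_expR oppr_le0.
Qed.

(** Between integer times the bounds persist by the extremum principles, and
    (1 - c)^k <= exp(- c k) <= exp(c) exp(- c t) for k the integer part of t. *)
Lemma flow_spread x r : (forall i, connect E i r) -> consensus_flow x ->
  exists C, forall i j t, 0 <= t ->
    `|x i t - x j t| <= C * expR (- contraction_rate * t).
Proof.
move=> Er fx.
pose M := \sum_i `|x i 0|.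
have xM i : `|x i 0| <= M by rewrite /M (bigD1 i)//= lerDl sumr_ge0.
have M0 : 0 <= M by apply: sumr_ge0.
have x0 j : - M <= x j 0 <= M by rewrite -ler_norml.
exists ((M + M) * expR contraction_rate) => i j t t0.
have /andP[kt tk] := truncn_itv t0; set k := Num.truncn t in kt tk.
have [ak [bk [xk abk]]] := flow_contraction Er fx x0 k.
have {}xk l : ak <= x l t <= bk.
  apply/andP; split.
    by apply: (flow_ge l fx (s := k%:R)) => [|m]; [rewrite ler0n|case/andP: (xk m)].
  by apply: (flow_le l fx (s := k%:R)) => [|m]; [rewrite ler0n|case/andP: (xk m)].
have : `|x i t - x j t| <= bk - ak.
  have /andP[? ?] := xk i; have /andP[? ?] := xk j.
  rewrite ler_norml; apply/andP; split; lra.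
move=> /le_trans; apply; rewrite abk opprK mulrC -mulrA ler_wpM2l ?addr_ge0//.
rewrite -expRD.
apply: (@le_trans _ _ (expR (- contraction_rate) ^+ k)).
  apply: lerXn2r; rewrite ?nnegrE ?subr_ge0 ?contraction_rate_le1 ?expR_ge0//.
  exact: expR_ge1Dx.
rewrite -expRM_natl ler_expR.
rewrite -natr1 in tk.
have : 0 <= contraction_rate * (k%:R + 1 - t).
  by rewrite mulr_ge0 ?(ltW contraction_rate_gt0)//; lra.
lra.
Qed.

(** The balance condition on w says that w is a left null vector of the
    Laplacian; self-loops appear on both sides and cancel. Applying the
    inequality to x and to - x gives the equality. *)
Lemma flow_weighted_sum x (w : 'I_n -> R) t : consensus_flow x ->
  (forall j, \sum_(i | E i j) w i = w j * \sum_(k | E j k) 1) -> 0 <= t ->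
  \sum_i w i * x i t = \sum_i w i * x i 0.
Proof.
move=> fx wE t0.
have fle y : consensus_flow y -> \sum_i w i * y i 0 <= \sum_i w i * y i t.
  move=> fy.
  have : (\sum_i w i \*: y i) 0 <= (\sum_i w i \*: y i) t; last by rewrite !fct_sumE.
  apply: (@le_of_derive_ge0 _
    (fun u => \sum_i w i *: \sum_(j | E i j) (y j u - y i u)) _ _ t0).
  - elim/big_ind: _ => [|f g cf cg|i _].
    + by move=> u; exact: cst_continuous.
    + by move=> u; apply: continuousD; [exact: cf|exact: cg].
    + move=> u; apply: cvgZl_tmp; exact: (flow_segment_continuous fy (lexx 0)).
  - move=> u /andP[u0 _]; apply: is_derive_sum => i; apply: is_deriveZ; exact: fy.2.
  - move=> u _.
    have -> : \sum_i w i * \sum_(j | E i j) (y j u - y i u) = 0; last by [].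
    under eq_bigr do rewrite mulr_sumr.
    under eq_bigr do under eq_bigr do rewrite mulrBr.
    under eq_bigr do rewrite sumrB.
    rewrite sumrB; apply/eqP; rewrite subr_eq0; apply/eqP.
    rewrite (exchange_big_dep predT)//=; apply: eq_bigr => j _.
    by rewrite -mulr_suml wE -mulrA -[RHS]mulr_sumr mulr_suml; under eq_bigr do rewrite mul1r.
apply/eqP; rewrite eq_le fle// andbT.
have := fle _ (consensus_flowN fx); rewrite -lerN2 -!sumrN.
under eq_bigr do rewrite fctE mulrN opprK.
by under [leRHS]eq_bigr do rewrite fctE mulrN opprK.
Qed.

(** The distance of x_i to the conserved average is a weighted average of the
    differences x_i - x_j. *)
Lemma consensus_exponential x r (w : 'I_n -> R) :
  (forall i, connect E i r) -> consensus_flow x ->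
  (forall j, \sum_(i | E i j) w i = w j * \sum_(k | E j k) 1) ->
  \sum_i w i = 1 ->
  exists C, forall i t, 0 <= t ->
    `|x i t - \sum_j w j * x j 0| <= C * expR (- contraction_rate * t).
Proof.
move=> Er fx wE w1; have [C xC] := flow_spread Er fx.
exists ((\sum_j `|w j|) * C) => i t t0.
rewrite -(flow_weighted_sum fx wE t0) -[x i t]mul1r -w1 mulr_suml -sumrB.
rewrite mulr_suml mulr_suml; apply: le_trans (ler_norm_sum _ _ _) _.
apply: ler_sum => j _; rewrite -mulrBr normrM -mulrA ler_wpM2l//.
exact: xC.
Qed.

End Consensus.

(** * The Gram-Schmidt procedure *)

Section GramSchmidt.
Context {R : realType}.
Implicit Types (Z A : 'M[R]_3) (a b c : 'cV[R]_3).

Lemma cols3E a b c : [/\ forall i, cols3 a b c i 0 = a i 0,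
  forall i, cols3 a b c i 1 = b i 0 & forall i, cols3 a b c i 2 = c i 0].
Proof. by split=> i; rewrite mxE. Qed.

Lemma cols3_col Z : cols3 (col 0 Z) (col 1 Z) (col 2 Z) = Z.
Proof.
apply/matrixP => i j; have [H0 H1 H2] := cols3E (col 0 Z) (col 1 Z) (col 2 Z).
case: j => [[|[|[|//]]] j3].
- by rewrite (_ : Ordinal j3 = 0) ?H0 ?mxE//; exact/val_inj.
- by rewrite (_ : Ordinal j3 = 1) ?H1 ?mxE//; exact/val_inj.
- by rewrite (_ : Ordinal j3 = 2) ?H2 ?mxE//; exact/val_inj.
Qed.

Lemma sum3E (f : 'I_3 -> R) : \sum_i f i = f 0 + f 1 + f 2.
Proof.
rewrite !big_ord_recl big_ord0 addr0 addrA; congr (_ + f _ + f _); exact/val_inj.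
Qed.

Lemma dotE a b : dot a b = a 0 0 * b 0 0 + a 1 0 * b 1 0 + a 2 0 * b 2 0.
Proof. exact: sum3E. Qed.

Lemma det_cols3 a b c : \det (cols3 a b c) =
  a 0 0 * (b 1 0 * c 2 0 - b 2 0 * c 1 0)
  - a 1 0 * (b 0 0 * c 2 0 - b 2 0 * c 0 0)
  + a 2 0 * (b 0 0 * c 1 0 - b 1 0 * c 0 0).
Proof.
rewrite (expand_det_col _ 0) sum3E /cofactor.
rewrite !(expand_det_row _ 0) !big_ord_recl !big_ord0 /cofactor !det_mx11 !mxE /=.
have -> : lift (0 : 'I_3) (0 : 'I_2) = 1 by exact/val_inj.
have -> : lift (1 : 'I_3) (0 : 'I_2) = 0 by exact/val_inj.
have -> : lift (2 : 'I_3) (0 : 'I_2) = 0 by exact/val_inj.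
have -> : lift (0 : 'I_3) (lift (0 : 'I_2) (0 : 'I_1)) = 2 by exact/val_inj.
have -> : lift (1 : 'I_3) (lift (0 : 'I_2) (0 : 'I_1)) = 2 by exact/val_inj.
have -> : lift (2 : 'I_3) (lift (0 : 'I_2) (0 : 'I_1)) = 1 by exact/val_inj.
rewrite (_ : bump 0 0 = 1)%N// (_ : 1 %% 3 = 1)%N// (_ : (1 + 1) %% 3 = 2)%N//.
by rewrite ?addn0 ?add0n expr0 expr1 sqrrN expr1n; ring.
Qed.

Lemma det_mx3 Z : \det Z =
  Z 0 0 * (Z 1 1 * Z 2 2 - Z 2 1 * Z 1 2)
  - Z 1 0 * (Z 0 1 * Z 2 2 - Z 2 1 * Z 0 2)
  + Z 2 0 * (Z 0 1 * Z 1 2 - Z 1 1 * Z 0 2).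
Proof. by rewrite -{1}[Z]cols3_col det_cols3 !mxE. Qed.

Lemma dotC a b : dot a b = dot b a. Proof. by rewrite !dotE; ring. Qed.

Lemma dotZl k a b : dot (k *: a) b = k * dot a b.
Proof. by rewrite !dotE !mxE; ring. Qed.

Lemma dotDl a b c : dot (a + b) c = dot a c + dot b c.
Proof. by rewrite !dotE !mxE; ring. Qed.

Lemma dotNl a b : dot (- a) b = - dot a b.
Proof. by rewrite !dotE !mxE; ring. Qed.

Lemma dot_gt0 a : a != 0 -> 0 < dot a a.
Proof.
move=> /matrix0Pn[i [j]]; rewrite (ord1 j) => ai.
rewrite /dot (bigD1 i)//= -expr2 ltr_wpDr//.
  by rewrite sumr_ge0// => l _; rewrite -expr2 sqr_ge0.
by rewrite lt_neqAle sqr_ge0 andbT eq_sym expf_eq0.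
Qed.

Lemma normalize_scale a : exists k, normalize a = k *: a.
Proof. by exists (Num.sqrt (dot a a))^-1. Qed.

Lemma dot_normalize a : a != 0 -> dot (normalize a) (normalize a) = 1.
Proof.
move=> /dot_gt0 a0; rewrite /normalize dotZl dotC dotZl.
have s0 : Num.sqrt (dot a a) != 0 by rewrite sqrtr_eq0 -ltNge.
have /esym := sqr_sqrtr (ltW a0); set s := Num.sqrt _ in s0 * => ->.
by field.
Qed.

Lemma dotE_mx a b : (a^T *m b) 0 0 = dot a b.
Proof. by rewrite mxE; apply: eq_bigr => i _; rewrite mxE. Qed.

Lemma dot_mulmx A a b : A^T *m A = 1%:M -> dot (A *m a) (A *m b) = dot a b.
Proof.
by move=> AA; rewrite -!dotE_mx trmx_mul -mulmxA [A^T *m _]mulmxA AA mul1mx.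
Qed.

Lemma normalize_mulmx A a : A^T *m A = 1%:M ->
  normalize (A *m a) = A *m normalize a.
Proof. by move=> AA; rewrite /normalize dot_mulmx// -scalemxAr. Qed.

Lemma mulmx_cols3 A a b c : A *m cols3 a b c = cols3 (A *m a) (A *m b) (A *m c).
Proof.
by apply/matrixP => i [[|[|[|//]]] j3]; rewrite !mxE /=; apply: eq_bigr => k _; rewrite mxE.
Qed.

Definition residual2 Z : 'cV[R]_3 :=
  let y1 := normalize (col 0 Z) in col 1 Z - dot (col 1 Z) y1 *: y1.
Definition residual3 Z : 'cV[R]_3 :=
  let y1 := normalize (col 0 Z) in let y2 := normalize (residual2 Z) in
  col 2 Z - (dot (col 2 Z) y1 *: y1 + dot (col 2 Z) y2 *: y2).
(** The orthonormal frame before the last vector is given the sign that makes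
    it direct. *)
Definition GS_frame Z : 'M[R]_3 :=
  cols3 (normalize (col 0 Z)) (normalize (residual2 Z)) (normalize (residual3 Z)).

Lemma GSOPE Z : GSOP Z =
  cols3 (normalize (col 0 Z)) (normalize (residual2 Z))
    (Num.sg (\det (GS_frame Z)) *: normalize (residual3 Z)).
Proof. by []. Qed.

(** A rotation preserves scalar products and determinants, the only quantities
    on which the coefficients of the procedure depend. *)
Lemma GSOP_mulmx A Z : SO3 A -> GSOP (A *m Z) = A *m GSOP Z.
Proof.
move=> [AA detA]; rewrite !GSOPE.
have c0 j : col j (A *m Z) = A *m col j Z by rewrite !colE mulmxA.
have r2 : residual2 (A *m Z) = A *m residual2 Z.
  by rewrite /residual2 !c0 normalize_mulmx// dot_mulmx// mulmxBr scalemxAr.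
have r3 : residual3 (A *m Z) = A *m residual3 Z.
  rewrite /residual3 r2 !c0 !normalize_mulmx// !dot_mulmx//.
  by rewrite mulmxBr mulmxDr !scalemxAr.
have -> : GS_frame (A *m Z) = A *m GS_frame Z.
  by rewrite /GS_frame mulmx_cols3 r2 r3 !c0 !normalize_mulmx.
by rewrite det_mulmx detA mul1r mulmx_cols3 r2 r3 !c0 !normalize_mulmx// scalemxAr.
Qed.

(** A vanishing residual expresses a column through the preceding ones, so the
    determinant would vanish. *)
Lemma residuals_neq0 Z : Z \in unitmx ->
  [/\ col 0 Z != 0, residual2 Z != 0 & residual3 Z != 0].
Proof.
rewrite unitmxE unitfE -{1}[Z]cols3_col det_cols3 => detZ.
split; apply: contraNneq detZ.
- by move=> ->; rewrite !mxE; apply/eqP; ring.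
- move/eqP; rewrite /residual2 /normalize subr_eq0 scalerA => /eqP ->.
  by rewrite !mxE; apply/eqP; ring.
- have [s2 y2E] := normalize_scale (residual2 Z).
  have [s1 y1E] := normalize_scale (col 0 Z).
  move/eqP; rewrite /residual3 subr_eq0 y2E /residual2 y1E => /eqP ->.
  by rewrite !mxE; apply/eqP; ring.
Qed.

Lemma cols3_gram a b c : dot a a = 1 -> dot b b = 1 -> dot c c = 1 ->
  dot b a = 0 -> dot c a = 0 -> dot c b = 0 ->
  (cols3 a b c)^T *m cols3 a b c = 1%:M.
Proof.
move=> aa bb cc ba ca cb.
have entry x y z (i j : 'I_3) : ((cols3 x y z)^T *m cols3 x y z) i j =
    dot (nth 0 [:: x; y; z] i) (nth 0 [:: x; y; z] j).
  by rewrite mxE; apply: eq_bigr => k _; rewrite !mxE.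
apply/matrixP => i j; rewrite entry mxE.
by case: i => [[|[|[|//]]] ?]; case: j => [[|[|[|//]]] ?];
  rewrite //= ?aa ?bb ?cc ?ba ?ca ?cb// dotC ?ba ?ca ?cb.
Qed.

Lemma GS_frame_ortho Z : Z \in unitmx -> (GS_frame Z)^T *m GS_frame Z = 1%:M.
Proof.
move=> /residuals_neq0[z1 z2 z3].
have y1 := dot_normalize z1; have y2 := dot_normalize z2.
have y3 := dot_normalize z3.
set a := normalize (col 0 Z) in y1 *.
have [k2 y2E] := normalize_scale (residual2 Z).
have [k3 y3E] := normalize_scale (residual3 Z).
have y21 : dot (normalize (residual2 Z)) a = 0.
  rewrite y2E dotZl; have -> : dot (residual2 Z) a = 0; last exact: mulr0.
  by rewrite /residual2 /= -/a dotDl dotNl dotZl y1 mulr1 subrr.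
set b := normalize (residual2 Z) in y2 y21 y2E *.
apply: cols3_gram => //; rewrite y3E dotZl.
- have -> : dot (residual3 Z) a = 0; last exact: mulr0.
  rewrite /residual3 /= -/a -/b dotDl dotNl dotDl.
  by rewrite [dot (_ *: a) a]dotZl [dot (_ *: b) a]dotZl y1 y21; ring.
- have -> : dot (residual3 Z) b = 0; last exact: mulr0.
  rewrite /residual3 /= -/a -/b dotDl dotNl dotDl.
  by rewrite [dot (_ *: a) b]dotZl [dot (_ *: b) b]dotZl y2 [dot a b]dotC y21; ring.
Qed.

Lemma det_GS_frame_sqr Z : Z \in unitmx -> \det (GS_frame Z) ^+ 2 = 1.
Proof.
by move=> /GS_frame_ortho /(congr1 determinant); rewrite det_mulmx det_tr det1 -expr2.
Qed.

Lemma det_GS_frame_neq0 Z : Z \in unitmx -> \det (GS_frame Z) != 0.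
Proof.
move=> /det_GS_frame_sqr d2; apply/eqP => d0; move: d2.
by rewrite d0 expr0n => /eqP; rewrite eq_sym oner_eq0.
Qed.

(** The final sign multiplies the determinant of the orthonormal frame, which
    is 1 or -1, by itself. *)
Lemma GSOP_SO3 Z : Z \in unitmx -> SO3 (GSOP Z).
Proof.
move=> uZ; have d2 := det_GS_frame_sqr uZ; have d0 := det_GS_frame_neq0 uZ.
have GSE : GSOP Z = GS_frame Z *m
    diag_mx (\row_j (if j == 2 then Num.sg (\det (GS_frame Z)) else 1)).
  apply/matrixP => i j; rewrite mul_mx_diag GSOPE !mxE.
  by case: j => [[|[|[|//]]] ?]; rewrite /= ?mxE ?mulr1// mulrC.
have sgd : Num.sg (\det (GS_frame Z)) * \det (GS_frame Z) = 1.
  by rewrite -normrEsg; apply/eqP; rewrite -sqrp_eq1// -normrX d2 normr1.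
split.
  rewrite GSE trmx_mul mulmxA -[_ *m _ *m GS_frame Z]mulmxA GS_frame_ortho// mulmx1.
  rewrite tr_diag_mx mulmx_diag; apply/matrixP => i j; rewrite !mxE; congr (_ *+ _).
  by case: ifP => _; rewrite ?mul1r// -expr2 sqr_sg d0.
rewrite GSE det_mulmx det_diag /=.
rewrite (bigD1 (2 : 'I_3))//= mxE eqxx big1 ?mulr1; last first.
  by move=> i /negbTE i2; rewrite mxE i2.
by rewrite mulrC.
Qed.

End GramSchmidt.

(** * Exponential convergence at a given rate *)

Section ExponentialConvergence.
Context {R : realType} (k : R) (k_gt0 : 0 < k).
Implicit Types (f g : R -> R) (l : R).

(** Asking the weighted error to tend to 0, rather than to be bounded, turns
    the closure properties below into the algebra of limits. The rate k is fixed
    once and for all since every quantity here inherits it from the consensus. *)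
Definition exp_cvg f l : Prop :=
  expR (k * t) * (f t - l) @[t --> +oo] --> (0 : R).

Lemma cvg_ext0 f g l : f @ +oo --> l -> l = 0 -> f =1 g -> g @ +oo --> (0 : R).
Proof. by move=> + <- /funext <-. Qed.

Lemma cvg_expRN c : 0 < c -> expR (- c * t) @[t --> +oo] --> (0 : R).
Proof.
move=> c0; apply/cvgrPdist_lt => /= e e0.
have /cvgrPdist_lt /(_ e e0) [M [Mr HM]] := @cvgr_expR R.
exists (M / c); split; first exact: num_real.
by move=> t; rewrite ltr_pdivrMr// mulrC mulNr => /HM.
Qed.

Lemma exp_cvg_bounded f l c C : k < c ->
  (forall t, 0 <= t -> `|f t - l| <= C * expR (- c * t)) -> exp_cvg f l.
Proof.
move=> kc fl; apply: norm_cvg0.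
apply: (@squeeze_cvgr _ _ _ _ (cst 0) (fun t => C * expR (- (c - k) * t))).
- near=> t; rewrite normr_ge0/= normrM ger0_norm ?expR_ge0//.
  have -> : - (c - k) * t = k * t + - c * t by ring.
  rewrite expRD mulrCA ler_wpM2l ?expR_ge0//; apply: fl.
  by near: t; exact: nbhs_pinfty_ge.
- exact: cvg_cst.
- rewrite -[0](mulr0 C); apply: cvgM; first exact: cvg_cst.
  by apply: cvg_expRN; rewrite subr_gt0.
Unshelve. all: by end_near. Qed.

Lemma exp_cvg_cvg f l : exp_cvg f l -> f t @[t --> +oo] --> l.
Proof.
move=> fl; apply/subr_cvg0.
rewrite -[0](mulr0 0).
have -> : (fun t => f t - l) = (fun t => expR (- k * t) * (expR (k * t) * (f t - l))).
  by apply/funext => t; rewrite mulrA -expRD mulNr addNr expR0 mul1r.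
by apply: cvgM => //; exact: cvg_expRN.
Qed.

Lemma exp_cvg_near f g l : (\forall t \near +oo, f t = g t) -> exp_cvg f l -> exp_cvg g l.
Proof.
move=> fg; apply: cvg_trans; apply: near_eq_cvg.
by near=> t; rewrite (near fg t).
Unshelve. all: by end_near. Qed.

Lemma exp_cvg_cst l : exp_cvg (cst l) l.
Proof.
by rewrite /exp_cvg; under eq_fun do rewrite subrr mulr0; exact: cvg_cst.
Qed.

Lemma exp_cvgD f g l m : exp_cvg f l -> exp_cvg g m ->
  exp_cvg (fun t => f t + g t) (l + m).
Proof.
move=> fl gm; apply: cvg_ext0 (cvgD fl gm) (addr0 0) _ => t.
by rewrite fctE; ring.
Qed.

Lemma exp_cvgN f l : exp_cvg f l -> exp_cvg (fun t => - f t) (- l).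
Proof.
by move=> fl; apply: cvg_ext0 (cvgN fl) (oppr0 _) _ => t; rewrite fctE; ring.
Qed.

Lemma exp_cvgB f g l m : exp_cvg f l -> exp_cvg g m ->
  exp_cvg (fun t => f t - g t) (l - m).
Proof. by move=> fl /exp_cvgN; exact: exp_cvgD. Qed.

(** f g - l m = (f - l) g + l (g - m), where g is convergent. *)
Lemma exp_cvgM f g l m : exp_cvg f l -> exp_cvg g m ->
  exp_cvg (fun t => f t * g t) (l * m).
Proof.
move=> fl gm.
apply: cvg_ext0 (cvgD (cvgM fl (exp_cvg_cvg gm)) (cvgM (cvg_cst l) gm)) _ _ => [|t].
  by rewrite mul0r mulr0 addr0.
by rewrite !fctE /=; ring.
Qed.

Lemma exp_cvg_sum n (f : 'I_n -> R -> R) (l : 'I_n -> R) :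
  (forall i, exp_cvg (f i) (l i)) ->
  exp_cvg (fun t => \sum_i f i t) (\sum_i l i).
Proof.
move=> fl; rewrite (_ : (fun t => _) = \sum_i f i); last by rewrite fct_sumE.
elim/big_ind2 : _ => [|g l1 h l2 gl hl|i _]; [exact: exp_cvg_cst|exact: exp_cvgD|exact: fl].
Qed.

(** 1/f - 1/l = - (f - l) / (f l), where the denominator tends to l^2 <> 0. *)
Lemma exp_cvgV f l : l != 0 -> exp_cvg f l -> exp_cvg (fun t => (f t)^-1) l^-1.
Proof.
move=> l0 fl; have fcl := exp_cvg_cvg fl.
have H : - (expR (k * t) * (f t - l)) * ((f t)^-1 * l^-1) @[t --> +oo] --> (0 : R).
  rewrite -(mul0r (l^-1 * l^-1)) -oppr0; apply: cvgM; first exact: cvgN.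
  by apply: cvgM; [exact: cvgV|exact: cvg_cst].
apply: cvg_trans H; apply: near_eq_cvg; near=> t.
have ft0 : f t != 0.
  by near: t; apply: cvgr_neq0; [exact: fcl|].
by field; rewrite ft0 l0.
Unshelve. all: by end_near. Qed.

(** The conjugate expression: sqrt f - sqrt l = (f - l) / (sqrt f + sqrt l). *)
Lemma exp_cvg_sqrt f l : 0 < l -> exp_cvg f l ->
  exp_cvg (fun t => Num.sqrt (f t)) (Num.sqrt l).
Proof.
move=> l0 fl; have fcl := exp_cvg_cvg fl.
have s0 : 0 < Num.sqrt l by rewrite sqrtr_gt0.
have H : (expR (k * t) * (f t - l)) * (Num.sqrt (f t) + Num.sqrt l)^-1 @[t --> +oo] --> (0 : R).
  rewrite -(mul0r (Num.sqrt l + Num.sqrt l)^-1); apply: cvgM => //.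
  apply: cvgV; first by rewrite gt_eqF// addr_gt0.
  apply: cvgD; last exact: cvg_cst.
  by apply: (cvg_comp _ _ fcl); exact: sqrt_continuous.
apply: cvg_trans H; apply: near_eq_cvg; near=> t.
have ft0 : 0 < f t by near: t; exact: cvgr_gt fcl _ l0.
have ss : 0 < Num.sqrt (f t) + Num.sqrt l by rewrite addr_gt0// sqrtr_gt0.
have /esym fE := sqr_sqrtr (ltW ft0); have /esym lE := sqr_sqrtr (ltW l0).
set u := Num.sqrt (f t) in ss fE *; set w := Num.sqrt l in ss lE *.
by rewrite fE lE; field; rewrite gt_eqF.
Unshelve. all: by end_near. Qed.

(** Near a nonzero limit the sign is eventually constant. *)
Lemma exp_cvg_sg f l : l != 0 -> exp_cvg f l ->
  exp_cvg (fun t => Num.sg (f t)) (Num.sg l).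
Proof.
move=> l0 fl; apply: (@exp_cvg_near (cst (Num.sg l))); last exact: exp_cvg_cst.
have fcl := exp_cvg_cvg fl.
have [l_gt0|l_lt0|l_eq0] := ltgtP l 0; last by rewrite l_eq0 eqxx in l0.
- near=> t; rewrite /= !ltr0_sg//; near: t; exact: cvgr_lt fcl _ _.
- near=> t; rewrite /= !gtr0_sg//; near: t; exact: cvgr_gt fcl _ _.
Unshelve. all: by end_near. Qed.

Definition mx_exp_cvg m n (F : R -> 'M[R]_(m, n)) (L : 'M[R]_(m, n)) : Prop :=
  forall i j, exp_cvg (fun t => F t i j) (L i j).

Lemma exp_cvg_ext f g l : f =1 g -> exp_cvg f l -> exp_cvg g l.
Proof. by move=> /funext ->. Qed.

Lemma mx_exp_cvgB m n (F G : R -> 'M[R]_(m, n)) L M : mx_exp_cvg F L -> mx_exp_cvg G M ->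
  mx_exp_cvg (fun t => F t - G t) (L - M).
Proof.
move=> FL GM i j; rewrite !mxE; apply: exp_cvg_ext (exp_cvgB (FL i j) (GM i j)) => t.
by rewrite !mxE.
Qed.

Lemma mx_exp_cvgN m n (F : R -> 'M[R]_(m, n)) L : mx_exp_cvg F L ->
  mx_exp_cvg (fun t => - F t) (- L).
Proof.
move=> FL i j; rewrite !mxE; apply: exp_cvg_ext (exp_cvgN (FL i j)) => t.
by rewrite !mxE.
Qed.

Lemma mx_exp_cvg_sub0 m n (F : R -> 'M[R]_(m, n)) L : mx_exp_cvg F L ->
  mx_exp_cvg (fun t => F t - L) 0.
Proof.
move=> FL; have := mx_exp_cvgB FL (fun i j => exp_cvg_cst (L i j)).
by rewrite subrr.
Qed.

Lemma mx_exp_cvgD m n (F G : R -> 'M[R]_(m, n)) L M : mx_exp_cvg F L -> mx_exp_cvg G M ->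
  mx_exp_cvg (fun t => F t + G t) (L + M).
Proof.
move=> FL GM i j; rewrite !mxE; apply: exp_cvg_ext (exp_cvgD (FL i j) (GM i j)) => t.
by rewrite !mxE.
Qed.

Lemma mx_exp_cvgZ m n f l (F : R -> 'M[R]_(m, n)) L : exp_cvg f l -> mx_exp_cvg F L ->
  mx_exp_cvg (fun t => f t *: F t) (l *: L).
Proof.
move=> fl FL i j; rewrite !mxE; apply: exp_cvg_ext (exp_cvgM fl (FL i j)) => t.
by rewrite !mxE.
Qed.

Lemma mx_exp_cvg_mul m n p (F : R -> 'M[R]_(m, n)) (G : R -> 'M[R]_(n, p)) L M :
  mx_exp_cvg F L -> mx_exp_cvg G M -> mx_exp_cvg (fun t => F t *m G t) (L *m M).
Proof.
move=> FL GM i j; rewrite mxE.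
apply: exp_cvg_ext (exp_cvg_sum (fun a => exp_cvgM (FL i a) (GM a j))) => t.
by rewrite mxE.
Qed.

Lemma mx_exp_cvg_tr m n (F : R -> 'M[R]_(m, n)) L : mx_exp_cvg F L ->
  mx_exp_cvg (fun t => (F t)^T) L^T.
Proof.
by move=> FL i j; rewrite mxE; apply: exp_cvg_ext (FL j i) => t; rewrite mxE.
Qed.

Lemma mx_exp_cvg_col m n (F : R -> 'M[R]_(m, n)) L j : mx_exp_cvg F L ->
  mx_exp_cvg (fun t => col j (F t)) (col j L).
Proof.
by move=> FL i o; rewrite mxE; apply: exp_cvg_ext (FL i j) => t; rewrite mxE.
Qed.

Lemma exp_cvg_dot (u w : R -> 'cV[R]_3) a b : mx_exp_cvg u a -> mx_exp_cvg w b ->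
  exp_cvg (fun t => dot (u t) (w t)) (dot a b).
Proof. by move=> ua wb; apply: exp_cvg_sum => i; exact: exp_cvgM. Qed.

Lemma mx_exp_cvg_normalize (u : R -> 'cV[R]_3) a : a != 0 -> mx_exp_cvg u a ->
  mx_exp_cvg (fun t => normalize (u t)) (normalize a).
Proof.
move=> /dot_gt0 a0 ua; apply: mx_exp_cvgZ => //.
by apply: exp_cvgV; [rewrite sqrtr_eq0 -ltNge|apply: exp_cvg_sqrt => //; exact: exp_cvg_dot].
Qed.

Lemma mx_exp_cvg_cols3 (u v w : R -> 'cV[R]_3) a b c :
  mx_exp_cvg u a -> mx_exp_cvg v b -> mx_exp_cvg w c ->
  mx_exp_cvg (fun t => cols3 (u t) (v t) (w t)) (cols3 a b c).
Proof.
move=> ua vb wc i [[|[|[|//]]] j3]; rewrite mxE /=;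
  [move: (ua i 0)|move: (vb i 0)|move: (wc i 0)]; apply: exp_cvg_ext => t;
  by rewrite mxE.
Qed.

Lemma exp_cvg_det3 (F : R -> 'M[R]_3) L : mx_exp_cvg F L ->
  exp_cvg (fun t => \det (F t)) (\det L).
Proof.
move=> FL; rewrite det_mx3.
apply: (@exp_cvg_ext (fun t => _)) => [t|]; first by rewrite det_mx3; reflexivity.
by apply: exp_cvgD; [apply: exp_cvgB|];
  (apply: exp_cvgM; first exact: FL); apply: exp_cvgB; apply: exp_cvgM; exact: FL.
Qed.

(** At an invertible limit no residual vanishes, and neither does the
    determinant of the frame: every operation of the procedure is regular there. *)
Lemma mx_exp_cvg_GSOP (F : R -> 'M[R]_3) L : L \in unitmx -> mx_exp_cvg F L ->
  mx_exp_cvg (fun t => GSOP (F t)) (GSOP L).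
Proof.
move=> uL FL; have [z1 z2 z3] := residuals_neq0 uL.
have Fc j := mx_exp_cvg_col j FL.
have c1 := mx_exp_cvg_normalize z1 (Fc 0).
have r2 : mx_exp_cvg (fun t => residual2 (F t)) (residual2 L).
  by apply: mx_exp_cvgB => //; apply: mx_exp_cvgZ => //; exact: exp_cvg_dot.
have c2 := mx_exp_cvg_normalize z2 r2.
have r3 : mx_exp_cvg (fun t => residual3 (F t)) (residual3 L).
  by apply: mx_exp_cvgB => //; apply: mx_exp_cvgD; apply: mx_exp_cvgZ => //; exact: exp_cvg_dot.
have c3 := mx_exp_cvg_normalize z3 r3.
apply: mx_exp_cvg_cols3 => //; apply: mx_exp_cvgZ => //.
apply: exp_cvg_sg; first exact: det_GS_frame_neq0.
apply: exp_cvg_det3; exact: mx_exp_cvg_cols3.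
Qed.

Lemma mx_cvg m n (F : R -> 'M[R]_(m, n)) (L : 'M[R]_(m, n)) :
  (forall i j, F t i j @[t --> +oo] --> L i j) -> F t @[t --> +oo] --> L.
Proof.
move=> FL; apply/cvgrPdist_le => /= e e0; near=> t.
rewrite /Num.Def.normr/= mx_normrE (bigmax_le _ (ltW e0))//= => i _.
rewrite !mxE; move: i; near: t; apply: filter_forall => /= i.
exact: ((cvgrPdist_le _ _).1 (FL i.1 i.2)).
Unshelve. all: by end_near. Qed.

End ExponentialConvergence.

(** * Rigid motions *)

Section Frames.
Context {R : realType}.
Implicit Types (A B : 'M[R]_3) (a b : 'cV[R]_3).

Lemma SO3_mulmxV A : SO3 A -> A *m A^T = 1%:M.
Proof. by case=> AA _; exact: mulmx1C. Qed.

Lemma SO3_entry_le1 A i j : SO3 A -> `|A i j| <= 1.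
Proof.
move=> [AA _]; have /matrixP/(_ j j) := AA; rewrite !mxE eqxx mulr1n => Aj.
rewrite -[leRHS]normr1 -ler_sqr ?nnegrE// ?normr_ge0// real_normK ?num_real//.
rewrite normr1 expr1n -Aj (bigD1 i)//= mxE -expr2 lerDl sumr_ge0// => k _.
by rewrite mxE -expr2 sqr_ge0.
Qed.

Lemma homogM A B a b : homog A a *m homog B b = homog (A *m B) (A *m b + a).
Proof.
by rewrite /homog mulmx_block !mul0mx !mulmx0 !mulmx1 !addr0 !add0r.
Qed.

Lemma homog_inv A a : SO3 A -> homog A a *m homog A^T (- (A^T *m a)) = 1%:M.
Proof.
move=> AS; rewrite homogM SO3_mulmxV// mulmxN mulmxA SO3_mulmxV// mul1mx addNr.
by rewrite /homog -scalar_mx_block.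
Qed.

Lemma homog_unitmx A a : SO3 A -> homog A a \in unitmx.
Proof. by move=> /homog_inv-/(_ a) /mulmx1_unit[]. Qed.

Lemma invmx_homog A a : SO3 A -> invmx (homog A a) = homog A^T (- (A^T *m a)).
Proof.
move=> AS; have uA := homog_unitmx a AS.
by rewrite -[RHS]mul1mx -(mulVmx uA) -mulmxA homog_inv// mulmx1.
Qed.

Lemma RhatE A B : SO3 A -> Rhat B = (GSOP (A *m B))^T *m A.
Proof.
move=> AS; rewrite GSOP_mulmx// trmx_mul -mulmxA; case: AS => -> _.
by rewrite mulmx1.
Qed.

End Frames.

(** * Consensus of the frames seen from the inertial frame *)

Section FrameConsensus.
Context {R : realType}.

Lemma is_derive_entry m n (X : R -> 'M[R]_(m, n)) (dX : 'M[R]_(m, n)) t i j :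
  is_derive t (1 : R) X dX -> is_derive t (1 : R) (fun u => X u i j) (dX i j).
Proof.
move=> [Xt <-]; apply: DeriveDef; first exact: (derivable_mxP _ _ _).1.
by rewrite derive_mx// mxE.
Qed.

Lemma is_derive_mulmx m n p (X : R -> 'M[R]_(m, n)) (Y : R -> 'M[R]_(n, p))
    dX dY t i j :
  is_derive t (1 : R) X dX -> is_derive t (1 : R) Y dY ->
  is_derive t (1 : R) (fun u => (X u *m Y u) i j) ((dX *m Y t + X t *m dY) i j).
Proof.
move=> dXt dYt.
have -> : (fun u => (X u *m Y u) i j) =
    \sum_k ((fun u => X u i k) * (fun u => Y u k j)).
  by rewrite fct_sumE; apply/funext => u; rewrite mxE.
have H k := is_deriveM (is_derive_entry i k dXt) (is_derive_entry k j dYt).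
apply: is_derive_eq (is_derive_sum H) _.
rewrite !mxE -big_split/=; apply: eq_bigr => k _.
by rewrite /GRing.scale /= addrC; congr (_ + _); rewrite mulrC.
Qed.

Lemma solves_entry_continuous m (X F : R -> 'M[R]_m) i j : solves X F ->
  {within `[0, +oo[, continuous (fun t => X t i j)}.
Proof.
move=> [cX _] t.
exact: (continuous_comp (cX t) (@coord_continuous R m m i j (X t))).
Qed.

(** The term T_i tw_i P_i coming from the kinematics of T_i cancels against the
    one of the law, and T_i (T_i^-1 T_j P_j - P_i) = S_j - S_i. *)
Lemma frame_flow n (E : rel 'I_n) (v omega : 'I_n -> R -> 'cV[R]_3)
    (T P : 'I_n -> R -> 'M[R]_(3 + 1)) :
  (forall i t, 0 <= t -> T i t \in unitmx) ->
  (forall i, solves (T i) (fun t => T i t *m twist (v i t) (omega i t))) ->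
  (forall i, solves (P i) (localization_law E v omega T P i)) ->
  forall a b, consensus_flow E (fun i t => (T i t *m P i t) a b).
Proof.
move=> uT sT sP a b; split=> [i|i t t0].
  have -> : (fun u => (T i u *m P i u) a b) =
      \sum_k ((fun u => T i u a k) * (fun u => P i u k b)).
    by rewrite fct_sumE; apply/funext => u; rewrite mxE.
  elim/big_ind: _ => [|f g cf cg|k _] u.
  - exact: cst_continuous.
  - by apply: continuousD; [exact: cf|exact: cg].
  - apply: continuousM; exact: solves_entry_continuous.
have := is_derive_mulmx a b ((sT i).2 t t0) ((sP i).2 t t0).
move=> H; apply: is_derive_eq H _.
rewrite /localization_law mulmxDr mulmxN mulmxA addNKr mulmx_sumr summxE.
apply: eq_bigr => j _.
by rewrite mulmxBr !mulmxA mulmxV ?uT ?ltW// mul1mx !mxE.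
Qed.

(** The j-th entry of w L = 0, with the self-loop of j, if any, added to both
    sides. *)
Lemma left_null_laplacianP n (E : rel 'I_n) (w : 'rV[R]_n) :
  w *m laplacian R E = 0 ->
  forall j, \sum_(i | E i j) w 0 i = w 0 j * \sum_(k | E j k) 1.
Proof.
move=> /matrixP wL j; have := wL 0 j; rewrite !mxE (bigD1 j)//= !mxE eqxx.
rewrite [X in _ + X](_ : _ = - \sum_(i | E i j && (i != j)) w 0 i); last first.
  rewrite -sumrN big_mkcond [RHS]big_mkcond/=; apply: eq_bigr => i _.
  by rewrite !mxE; case: eqVneq => ij; rewrite ?andbF//; case: (E i j); rewrite /= ?mulrN1 ?mulr0.
move=> /eqP; rewrite subr_eq0 => /eqP wj.
case Ejj : (E j j); last first.
  have dropl (P : pred 'I_n) : P j = false -> (fun i => P i && (i != j)) =1 P.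
    by move=> Pj i; case: eqVneq => [->|_]; rewrite ?Pj ?andbT.
  rewrite (eq_bigl _ _ (dropl (E j) Ejj)) in wj.
  by rewrite wj (eq_bigl _ _ (dropl (E^~ j) Ejj)).
by rewrite (bigD1 j)//= [in RHS](bigD1 j)//= mulrDr mulr1 wj.
Qed.

Lemma mxtens_mul_Z0 n (w : 'rV[R]_n) (A B : 'I_n -> 'M[R]_3) (x : 'cV[R]_3) :
  (w *t (1%:M : 'M[R]_3)) *m (Z0 A B *m x) = Qc w A B *m x.
Proof.
rewrite mulmxA; congr (_ *m _); apply/matrixP => r c.
rewrite mxE /Qc summxE.
rewrite (reindex (@mxtens_index n 3)) /=; last first.
  by exists (@mxtens_unindex n 3) => k _; rewrite (mxtens_indexK, mxtens_unindexK).
transitivity (\sum_(i < n) \sum_(j < 3) (w *t (1%:M : 'M[R]_3)) r (mxtens_index (i, j))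
    * Z0 A B (mxtens_index (i, j)) c).
  by rewrite pair_bigA; apply: eq_bigr => -[].
apply: eq_bigr => i _.
have r1 : (@mxtens_unindex 1 3 r).1 = 0 by exact: ord1.
have r2 : (@mxtens_unindex 1 3 r).2 = r :> 'I_3.
  by apply/val_inj; rewrite /= modn_small// (ltn_ord r).
rewrite (bigD1 (r : 'I_3))//= [X in _ + X]big1 ?addr0.
  by rewrite !mxE !mxtens_indexK r1 r2 eqxx mulr1.
by move=> j jr; rewrite !mxE !mxtens_indexK r2 eq_sym (negbTE jr) mulr0 mul0r.
Qed.

(** If Qc x = 0 then Z0 x lies in the range of Z0 and in the null space of
    w (x) I, so Z0 x = 0; the block of a single agent with invertible factors
    then gives x = 0. *)
Lemma Qc_unitmx n (w : 'rV[R]_n) (A B : 'I_n -> 'M[R]_3) (i0 : 'I_n) :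
  A i0 \in unitmx -> B i0 \in unitmx ->
  col_range (Z0 A B) `&` col_null (w *t (1%:M : 'M[R]_3)) = [set 0] ->
  Qc w A B \in unitmx.
Proof.
move=> uA uB Z0w; rewrite unitmxE unitfE; apply/negP => /eqP detQ.
have /eqP/det0P[x x0 xQ] : \det (Qc w A B)^T = 0 by rewrite det_tr.
have Qx : Qc w A B *m x^T = 0 by apply: trmx_inj; rewrite trmx_mul trmxK trmx0.
have : (col_range (Z0 A B) `&` col_null (w *t (1%:M : 'M[R]_3))) (Z0 A B *m x^T).
  by split; [exists x^T|rewrite /col_null /= mxtens_mul_Z0].
rewrite Z0w /= => Zx; move/negP: x0; apply; apply/eqP.
have ABx : A i0 *m B i0 *m x^T = 0.
  apply/matrixP => r c; have /matrixP/(_ (mxtens_index (i0, r)) c) := Zx.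
  rewrite mxE [RHS]mxE => Zx0; rewrite mxE [RHS]mxE -[RHS]Zx0; apply: eq_bigr => k _.
  by congr (_ * _); rewrite [RHS]mxE mxtens_indexK.
by apply: trmx_inj; rewrite trmx0 -(mulKmx uB x^T)
  -(mulKmx uA (B i0 *m x^T)) [A i0 *m _]mulmxA ABx !mulmx0.
Qed.


Lemma mx_exp_cvg_homog k (A : R -> 'M[R]_3) (b : R -> 'cV[R]_3) LA Lb :
  mx_exp_cvg k A LA -> mx_exp_cvg k b Lb ->
  mx_exp_cvg k (fun t => homog (A t) (b t)) (homog LA Lb).
Proof.
move=> Al bl i j.
case: (split_ordP i) => i' ->; case: (split_ordP j) => j' ->.
- rewrite block_mxEul; apply: exp_cvg_ext (Al i' j') => t; by rewrite block_mxEul.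
- rewrite block_mxEur; apply: exp_cvg_ext (bl i' j') => t; by rewrite block_mxEur.
- rewrite block_mxEdl; apply: exp_cvg_ext (exp_cvg_cst k _) => t; by rewrite block_mxEdl.
- rewrite block_mxEdr; apply: exp_cvg_ext (exp_cvg_cst k _) => t; by rewrite block_mxEdr.
Qed.

Lemma mx_exp_cvg_mx_cvg k m n (F : R -> 'M[R]_(m, n)) L : 0 < k ->
  mx_exp_cvg k F L -> F t @[t --> +oo] --> L.
Proof. by move=> k0 FL; apply: mx_cvg => i j; exact: (exp_cvg_cvg k0 (FL i j)). Qed.

(** The exponential weight is moved from the decaying factor to the growing
    one. *)
Lemma exp_cvg0_mul_cvg0 k m n p (F : R -> 'M[R]_(m, n)) (G : R -> 'M[R]_(n, p)) :
  mx_exp_cvg k F 0 -> (expR (- k * t) *: G t) @[t --> +oo] --> (0 : 'M[R]_(n, p)) ->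
  F t *m G t @[t --> +oo] --> (0 : 'M[R]_(m, p)).
Proof.
move=> F0 G0; apply: mx_cvg => i j; rewrite mxE.
have -> : (fun t => (F t *m G t) i j) =
    \sum_l ((fun t => expR (k * t) * (F t i l - 0)) *
             (fun t => (expR (- k * t) *: G t) l j)).
  rewrite fct_sumE; apply/funext => t; rewrite mxE; apply: eq_bigr => l _.
  by rewrite fctE mxE subr0 mulrACA -expRD mulNr subrr expR0 mul1r.
elim/big_ind: _ => [|f g f0 g0|l _]; first exact: cvg_cst.
  by have := cvgD f0 g0; rewrite addr0; apply.
have Gl : (expR (- k * t) *: G t) l j @[t --> +oo] --> (0 : R).
  have := @coord_continuous R n p l j 0; rewrite /continuous_at mxE.
  by move=> /(cvg_comp _ _ G0).
by have := F0 i l; rewrite /exp_cvg mxE => Fl; have := cvgM Fl Gl; rewrite mulr0; apply.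
Qed.

End FrameConsensus.

(** * Convergence of the estimates *)

(** The entries of T_i P_i all contract at the same rate c; half of it, k = c/2,
    turns the bound C exp(- c t) into convergence at rate k. The limits are the
    upper blocks of the weighted average of the T_j(0) P_j(0). *)
Lemma auxiliary_frames_converge (R : realType) (n : nat) (E : rel 'I_n) (w1 : 'rV[R]_n)
  (Rot : 'I_n -> R -> 'M[R]_3) (p v omega : 'I_n -> R -> 'cV[R]_3)
  (Q : 'I_n -> R -> 'M[R]_3) (q : 'I_n -> R -> 'cV[R]_3) :
  has_spanning_tree E -> w1 *m laplacian R E = 0 ->
  w1 *m const_mx 1 = 1%:M :> 'M[R]_1 ->
  (forall i t, 0 <= t -> SO3 (Rot i t)) ->
  (forall i, solves (frames Rot p i)
     (fun t => frames Rot p i t *m twist (v i t) (omega i t))) ->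
  (forall i, solves (frames Q q i)
     (localization_law E v omega (frames Rot p) (frames Q q) i)) ->
  exists2 k, 0 < k & forall i,
    mx_exp_cvg k (fun t => Rot i t *m Q i t) (Qc w1 (Rot^~ 0) (Q^~ 0)) /\
    mx_exp_cvg k (fun t => Rot i t *m q i t + p i t)
      (qc w1 (Rot^~ 0) (p^~ 0) (q^~ 0)).
Proof.
move=> [r Er] w1L w11 RotS sT sP.
have sum1 : \sum_i w1 0 i = 1.
  have /matrixP/(_ 0 0) := w11; rewrite !mxE eqxx mulr1n => <-.
  by apply: eq_bigr => i _; rewrite mxE mulr1.
have uT i t : 0 <= t -> frames Rot p i t \in unitmx.
  by move=> t0; exact/homog_unitmx/RotS.
have flow := frame_flow uT sT sP.
have c0 := @contraction_rate_gt0 R n.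
pose k := @contraction_rate R n / 2.
have kc : k < @contraction_rate R n by rewrite /k; lra.
exists k; first by rewrite divr_gt0.
have cvgS i a b : exp_cvg k (fun t => (frames Rot p i t *m frames Q q i t) a b)
    (\sum_j w1 0 j * (frames Rot p j 0 *m frames Q q j 0) a b).
  have [C HC] := consensus_exponential Er (flow a b) (left_null_laplacianP w1L) sum1.
  exact: exp_cvg_bounded kc (HC i).
move=> i; split=> a b.
  have -> : Qc w1 (Rot^~ 0) (Q^~ 0) a b = \sum_j w1 0 j *
      (frames Rot p j 0 *m frames Q q j 0) (lshift 1 a) (lshift 1 b).
    by rewrite summxE; apply: eq_bigr => j _; rewrite mxE homogM block_mxEul.
  apply: exp_cvg_ext (cvgS i (lshift 1 a) (lshift 1 b)) => t.
  by rewrite homogM block_mxEul.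
have -> : qc w1 (Rot^~ 0) (p^~ 0) (q^~ 0) a b = \sum_j w1 0 j *
    (frames Rot p j 0 *m frames Q q j 0) (lshift 1 a) (rshift 3 b).
  by rewrite summxE; apply: eq_bigr => j _; rewrite mxE homogM block_mxEur.
apply: exp_cvg_ext (cvgS i (lshift 1 a) (rshift 3 b)) => t.
by rewrite homogM block_mxEur.
Qed.

Lemma SO3_subexponential (R : realType) (A : R -> 'M[R]_3) (k : R) : 0 < k ->
  (forall t, 0 <= t -> SO3 (A t)) ->
  expR (- k * t) *: A t @[t --> +oo] --> (0 : 'M[R]_3).
Proof.
move=> k0 AS; apply: mx_cvg => i j; rewrite mxE; apply: norm_cvg0.
apply: (@squeeze_cvgr _ _ _ _ (cst 0) (fun t => expR (- k * t))).
- near=> t; rewrite normr_ge0 mxE normrM ger0_norm ?expR_ge0//=.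
  rewrite -[leRHS]mulr1 ler_wpM2l ?expR_ge0// SO3_entry_le1//; apply: AS.
  by near: t; exact: nbhs_pinfty_ge.
- exact: cvg_cst.
- exact: cvg_expRN.
Unshelve. all: by end_near. Qed.

Lemma cvg_eq_nonneg (R : realType) m n (f g : R -> 'M[R]_(m, n)) (l : 'M[R]_(m, n)) :
  f t @[t --> +oo] --> l -> (forall t, 0 <= t -> f t = g t) ->
  g t @[t --> +oo] --> l.
Proof.
move=> fl fg; apply: cvg_trans fl; apply: near_eq_cvg.
by near=> t; apply: fg; near: t; exact: nbhs_pinfty_ge.
Unshelve. all: by end_near. Qed.

Lemma upper_block_cvg0 (R : realType) (A : R -> 'M[R]_3) (b : R -> 'cV[R]_3) :
  A t @[t --> +oo] --> (0 : 'M[R]_3) -> b t @[t --> +oo] --> (0 : 'cV[R]_3) ->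
  block_mx (A t) (b t) 0 0 @[t --> +oo] --> (0 : 'M[R]_(3 + 1)).
Proof.
move=> A0 b0; apply: mx_cvg => i j; rewrite mxE.
case: (split_ordP i) => i' ->; case: (split_ordP j) => j' ->.
- under eq_fun do rewrite block_mxEul.
  have := @coord_continuous R 3 3 i' j' 0; rewrite /continuous_at mxE.
  by move=> /(cvg_comp _ _ A0).
- under eq_fun do rewrite block_mxEur.
  have := @coord_continuous R 3 1 i' j' 0; rewrite /continuous_at mxE.
  by move=> /(cvg_comp _ _ b0).
- by under eq_fun do rewrite block_mxEdl mxE; exact: cvg_cst.
- by under eq_fun do rewrite block_mxEdr mxE; exact: cvg_cst.
Qed.

Theorem corollary1 (R : realType) (n : nat) (E : rel 'I_n) (w1 : 'rV[R]_n)
  (Rot : 'I_n -> R -> 'M[R]_3) (p v omega : 'I_n -> R -> 'cV[R]_3)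
  (Q : 'I_n -> R -> 'M[R]_3) (q : 'I_n -> R -> 'cV[R]_3)
  (E_tree : has_spanning_tree E)
  (w1_left : w1 *m laplacian R E = 0)
  (w1_normalized : w1 *m const_mx 1 = 1%:M :> 'M[R]_1)
  (Rot_SO3 : forall i t, 0 <= t -> SO3 (Rot i t))
  (T_kinematics : forall i, solves (frames Rot p i)
     (fun t => frames Rot p i t *m twist (v i t) (omega i t)))
  (Q0_nonsingular : forall i, Q i 0 \in unitmx)
  (P_law : forall i, solves (frames Q q i)
     (localization_law E v omega (frames Rot p) (frames Q q) i))
  (Z0_null : col_range (Z0 (Rot^~ 0) (Q^~ 0)) `&` col_null (w1 *t (1%:M : 'M[R]_3))
     = [set 0]) :
  let Rc := GSOP (Qc w1 (Rot^~ 0) (Q^~ 0)) in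
  let qc := qc w1 (Rot^~ 0) (p^~ 0) (q^~ 0) in
  exists Tc : 'M[R]_(3 + 1),
    [/\ Tc = homog Rc qc,
        SE3 Tc &
        forall i,
        [/\ Rhat (Q i t) - Rc^T *m Rot i t @[t --> +oo] --> (0 : 'M[R]_3),
            That (Q i t) (q i t) *m invmx (frames Rot p i t)
              @[t --> +oo] --> invmx Tc &
            subexponential (p i) ->
              That (Q i t) (q i t) - invmx Tc *m frames Rot p i t
                @[t --> +oo] --> (0 : 'M[R]_(3 + 1)) /\
              phat (Q i t) (q i t) - Rc^T *m (p i t - qc)
                @[t --> +oo] --> (0 : 'cV[R]_3)]].
Proof.
move=> Rc qc; exists (homog Rc qc).
have [r Er] := E_tree.
have uQc : Qc w1 (Rot^~ 0) (Q^~ 0) \in unitmx.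
  apply: (@Qc_unitmx R n w1 (Rot^~ 0) (Q^~ 0) r) => //.
  by have [_ dR] := Rot_SO3 r 0 (lexx 0); rewrite unitmxE dR unitr1.
have RcS : SO3 Rc := GSOP_SO3 uQc.
split=> // [|i]; first by exists Rc, qc.
have [k k0 /(_ i)[RQ s_cvg]] := auxiliary_frames_converge E_tree w1_left w1_normalized
  Rot_SO3 T_kinematics P_law.
pose G t := GSOP (Rot i t *m Q i t).
pose s t := Rot i t *m q i t + p i t.
have GT_cvg : mx_exp_cvg k (fun t => (G t)^T) Rc^T.
  by apply: mx_exp_cvg_tr; exact: mx_exp_cvg_GSOP.
have GTs_cvg : mx_exp_cvg k (fun t => - ((G t)^T *m s t)) (- (Rc^T *m qc)).
  by apply: mx_exp_cvgN; exact: mx_exp_cvg_mul.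
have dG0 : mx_exp_cvg k (fun t => (G t)^T - Rc^T) 0.
  exact: mx_exp_cvg_sub0.
have RhatG t : 0 <= t -> Rhat (Q i t) = (G t)^T *m Rot i t.
  by move=> /(Rot_SO3 i) RS; exact: RhatE.
have phatG t : 0 <= t -> phat (Q i t) (q i t) = - ((G t)^T *m s t) + (G t)^T *m p i t.
  by move=> t0; rewrite /phat RhatG// /s mulmxDr opprD addrNK mulmxA.
(* Only these limits and formulas matter below, not how the Gram-Schmidt
   frames are built. *)
clearbody G s Rc qc.
have Rot_cvg : Rhat (Q i t) - Rc^T *m Rot i t @[t --> +oo] --> (0 : 'M[R]_3).
  apply: cvg_eq_nonneg (exp_cvg0_mul_cvg0 dG0 (SO3_subexponential k0 (Rot_SO3 i))) _ => t t0.
  by rewrite RhatG// mulmxBl.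
split=> //.
- rewrite invmx_homog//.
  apply: cvg_eq_nonneg (mx_exp_cvg_mx_cvg k0 (mx_exp_cvg_homog GT_cvg GTs_cvg)) _ => t t0.
  have RS := Rot_SO3 i t t0; rewrite /frames invmx_homog// /That homogM.
  congr homog; first by rewrite RhatG// -mulmxA SO3_mulmxV// mulmx1.
  rewrite phatG// RhatG// mulmxN mulmxA -[_ *m _ *m (Rot i t)^T]mulmxA.
  by rewrite SO3_mulmxV// mulmx1 addrC addrK.
- move=> sub_p.
  have p_cvg : phat (Q i t) (q i t) - Rc^T *m (p i t - qc)
      @[t --> +oo] --> (0 : 'cV[R]_3).
    have := cvgD (mx_exp_cvg_mx_cvg k0 (mx_exp_cvg_sub0 GTs_cvg))
      (exp_cvg0_mul_cvg0 dG0 (sub_p k k0)).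
    rewrite addr0 => /(_ _) H; apply: cvg_eq_nonneg H _ => t t0.
    by rewrite phatG// mulmxBr mulmxBl opprK opprB addrACA.
  split=> //; rewrite invmx_homog//.
  have H := @upper_block_cvg0 R (fun t => Rhat (Q i t) - Rc^T *m Rot i t)
    (fun t => phat (Q i t) (q i t) - Rc^T *m (p i t - qc)) Rot_cvg p_cvg.
  apply: cvg_eq_nonneg H _ => t t0.
  rewrite /frames homogM /That /homog opp_block_mx add_block_mx.
  by rewrite oppr0 addr0 subrr mulmxBr.
Qed.
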